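(* Let $G=G^{(0)}$ be a framed braid graph on $b$ strands with no strands closed (with an arbitrary framing), and for $0\le k\le b-1$ let $G^{(k)}$ be the framed graph obtained by closing the right-most $k$ strands of $G$. Let $\pi_k:\mathcal{E}(G^{(k)})\to\mathcal{E}(G^{(k+1)})$ be the projection of edge rings corresponding to closing the $(k+1)$-st strand, and let $z_\tau^{(k+1)}$ be the edge ring variable of the top boundary edge of the $(k+1)$-st strand of $G^{(k)}$. Then for every $0\le k\le b-2$ the equality of ideals $$\pi_k\big(N(G^{(k)})\big):\big(z_\tau^{(k+1)}\big)=N\big(G^{(k+1)}\big)$$ holds in $\mathcal{E}(G^{(k+1)})$, where $N(\cdot)$ denotes the non-local ideal and $I:J=\{r: rJ\subset I\}$ is the ideal quotient.
   Context: **Ground ring.** $\mathcal{R}=\mathbb{F}[t^{-1},t]]$ is the ring (field) of Laurent series in $t$ over a field $\mathbb{F}$. **Braid graphs.** Take an open braid diagram on $b$ strands, oriented upward, and replace each crossing by a thick edge: a vertical edge whose bottom vertex receives two incoming thin edges (from below) and whose top vertex emits two outgoing thin edges (above). Bivalent vertices (one incoming, one outgoing thin edge) are also allowed on strands, and every connected component contains at least one thick edge or bivalent vertex. The resulting planar oriented graph $G$ has thin edges, among them $b$ bottom boundary edges and $b$ top boundary edges. Positions (strands) are numbered $1,\dots,b$ from right to left at the top and at the bottom. **Framing.** A framing assigns an integer $\ell_e$ to each thin edge $e$ (thick edges are blackboard framed, i.e. carry $0$). **Closing strands.** $G^{(k)}$ is obtained from $G$ by joining, for each $1\le i\le k$,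 the top boundary edge in position $i$ to the bottom boundary edge in position $i$ (around the right side of the diagram), forming one thin edge whose framing is the sum of the two framings; all other framings are inherited. **Edge ring.** For a framed graph $H$, give each thin edge $e$ two variables $x_e$ (first segment with respect to the orientation) and $y_e$ (second segment). The edge ring is $\mathcal{E}(H)=\mathcal{R}[x_e,y_e]/(t^{\ell_e}y_e-x_e)_e\cong\mathcal{R}[x_e : e \text{ a thin edge of } H]$, so $y_e=t^{-\ell_e}x_e$. Write $z_\tau^{(i)}$ and $z_\beta^{(i)}$ for the variables $x_e$ of the top, respectively bottom, boundary edge of $G$ in position $i$, and $a_i$ for the framing of the top boundary edge of $G$ in position $i$. The joined edge in position $i$ of $G^{(k)}$ ($i\le k$) carries the variable $z_\tau^{(i)}$. The map $\pi_k:\mathcal{E}(G^{(k)})\to\mathcal{E}(G^{(k+1)})$ is the surjective $\mathcal{R}$-algebra map with kernel $(z_\tau^{(k+1)}-t^{a_{k+1}}z_\beta^{(k+1)})$ that sends $z_\beta^{(k+1)}\mapsto t^{-a_{k+1}}z_\tau^{(k+1)}$ and fixes all other variables. **Non-local ideal.** For a set $\Gamma$ of thick edges and bivalent vertices of $H$, let $\mathbf{w}(\Gamma)$ be the sum of the framings of the thin edges internal to $\Gamma$ (both ends incident to elements of $\Gamma$); let $x_{\Gamma,\mathrm{out}}$ be the product of $x_e$ over thin edges $e$ going from $\Gamma$ to its complement (including to the top boundary), and $y_{\Gamma,\mathrm{in}}$ the product of $y_e$ over thin edges $e$ going into $\Gamma$ from its complement (including from the bottom boundary). Then $N(H)\subset\mathcal{E}(H)$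 is the ideal generated by the images of $t^{\mathbf{w}(\Gamma)}x_{\Gamma,\mathrm{out}}-y_{\Gamma,\mathrm{in}}$ for all such sets $\Gamma$. *)

(* Defs.v *)
From HB Require Import structures.
From mathcomp Require Import all_boot all_order all_algebra.
From mathcomp Require Import boolp.
From mathcomp Require Import mpoly.

Set Implicit Arguments.
Unset Strict Implicit.
Unset Printing Implicit Defensive.

Import GRing.Theory.
Local Open Scope ring_scope.

Declare Scope fps_scope.
Local Open Scope fps_scope.

(** * The field of Laurent series

    F[t^-1, t]] is obtained from F[[t]] by inverting t. Since every nonzero
    power series is a power of t times a unit, this is also the fraction field
    of F[[t]], which is how it is built here; [laurentP] checks that every
    element is of the form t^-n * f with f a power series. *)

Record fps (F : fieldType) := Fps { fps_coef : nat -> F }.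
Arguments Fps {F}.

Notation "f `[ n ]" := (fps_coef f n)
  (at level 2, left associativity, format "f `[ n ]") : fps_scope.

Section PowerSeries.
Variable F : fieldType.
Implicit Types f g h : fps F.

Lemma fpsP f g : (forall n, f`[n] = g`[n]) -> f = g.
Proof. by case: f g => [f] [g] /= /funext ->. Qed.

HB.instance Definition _ := gen_eqMixin (fps F).
HB.instance Definition _ := gen_choiceMixin (fps F).

Definition fps_add f g : fps F := Fps (fun n => f`[n] + g`[n]).
Definition fps_opp f : fps F := Fps (fun n => - f`[n]).
Definition fps_zero : fps F := Fps (fun=> 0).
Definition fps_one : fps F := Fps (fun n => (n == 0%N)%:R).
Definition fps_mul f g : fps F :=
  Fps (fun n => \sum_(i < n.+1) f`[i] * g`[n - i]).

Fact fps_addA : associative fps_add.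
Proof. by move=> f g h; apply: fpsP => n; apply: addrA. Qed.
Fact fps_addC : commutative fps_add.
Proof. by move=> f g; apply: fpsP => n; apply: addrC. Qed.
Fact fps_add0 : left_id fps_zero fps_add.
Proof. by move=> f; apply: fpsP => n; apply: add0r. Qed.
Fact fps_addN : left_inverse fps_zero fps_opp fps_add.
Proof. by move=> f; apply: fpsP => n; apply: addNr. Qed.

HB.instance Definition _ :=
  GRing.isZmodule.Build (fps F) fps_addA fps_addC fps_add0 fps_addN.

Definition fps_trunc N f : {poly F} := \poly_(i < N) f`[i].

Lemma coef_trunc N f n : (n < N)%N -> (fps_trunc N f)`_n = f`[n].
Proof. by rewrite coef_poly => ->. Qed.

Lemma fps_coef_mul N f g n : (n < N)%N ->
  (fps_mul f g)`[n] = (fps_trunc N f * fps_trunc N g)`_n.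
Proof.
move=> nN; rewrite coefM; apply: eq_bigr => i _.
by rewrite !coef_trunc // (leq_trans _ nN) ?ltn_ord // ltnS leq_subr.
Qed.

Fact fps_mulC : commutative fps_mul.
Proof.
by move=> f g; apply: fpsP => n; rewrite !(@fps_coef_mul n.+1) // mulrC.
Qed.

Fact fps_mulA : associative fps_mul.
Proof.
move=> f g h; apply: fpsP => n.
transitivity (fps_trunc n.+1 f * (fps_trunc n.+1 g * fps_trunc n.+1 h))`_n.
  rewrite coefM; apply: eq_bigr => i _.
  by rewrite coef_trunc // (@fps_coef_mul n.+1) // ltnS leq_subr.
rewrite mulrA coefM; apply: eq_bigr => i _.
by rewrite [in RHS](@fps_coef_mul n.+1) // coef_trunc // ltnS leq_subr.
Qed.

Fact fps_mul1 : left_id fps_one fps_mul.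
Proof.
move=> f; apply: fpsP => n; rewrite /= big_ord_recl /= mul1r subn0.
by rewrite big1 ?addr0 // => i _; rewrite mul0r.
Qed.

Fact fps_mulD : left_distributive fps_mul fps_add.
Proof.
move=> f g h; apply: fpsP => n; rewrite /= -big_split.
by apply: eq_bigr => i _; rewrite mulrDl.
Qed.

Fact fps_one_neq0 : fps_one != fps_zero.
Proof.
by apply/eqP => /(congr1 (fun f => f`[0])) /eqP /=; rewrite oner_eq0.
Qed.

HB.instance Definition _ := GRing.Zmodule_isComNzRing.Build (fps F)
  fps_mulA fps_mulC fps_mul1 fps_mulD fps_one_neq0.

Definition fps_unit : pred (fps F) := fun f => `[< exists g, g * f = 1 >].

Definition fps_inv f : fps F :=
  if pselect (exists g, g * f = 1) is left e then projT1 (cid e) else f.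

Fact fps_mulVx : {in fps_unit, left_inverse 1 fps_inv *%R}.
Proof.
move=> f /asboolP uf; rewrite /fps_inv; case: pselect => // e.
exact: projT2 (cid e).
Qed.

Fact fps_unitP f g : g * f = 1 -> fps_unit f.
Proof. by move=> gf; apply/asboolP; exists g. Qed.

Fact fps_inv_out : {in [predC fps_unit], fps_inv =1 id}.
Proof.
move=> f /negP uf; rewrite /fps_inv; case: pselect => // e.
by case: uf; apply/asboolP.
Qed.

HB.instance Definition _ := GRing.ComNzRing_hasMulInverse.Build (fps F)
  fps_mulVx fps_unitP fps_inv_out.

Lemma fps_ord f : f != 0 ->
  exists2 m, f`[m] != 0 & forall i, (i < m)%N -> f`[i] = 0.
Proof.
move=> f0; have ex : exists m, f`[m] != 0.
  apply: contrapT => /forallNP h; case/eqP: f0; apply: fpsP => n.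
  by move/negP: (h n); rewrite negbK => /eqP.
exists (ex_minn ex); case: ex_minnP => // m _ mmin i im.
by apply/eqP; apply: contraLR im => /mmin; rewrite -leqNgt.
Qed.

Fact fps_mul_eq0 f g : f * g = 0 -> (f == 0) || (g == 0).
Proof.
move=> fg; apply: contraT; rewrite negb_or => /andP[/fps_ord[m fm fl]].
move=> /fps_ord[n gn gl].
have /(congr1 (fun h => h`[(m + n)%N])) := fg.
have mlt : (m < (m + n).+1)%N by rewrite ltnS leq_addr.
rewrite /= (bigD1 (Ordinal mlt)) //= addKn big1 => [|i ne].
  by rewrite addr0 => /eqP; rewrite mulf_eq0 (negPf fm) (negPf gn).
have [im|mi|e] := ltngtP i m; first by rewrite fl ?mul0r.
  rewrite gl ?mulr0 // ltn_subLR ?ltn_add2r //.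
  by rewrite -ltnS.
by case/eqP: ne; apply: val_inj.
Qed.

HB.instance Definition _ :=
  GRing.ComUnitRing_isIntegral.Build (fps F) fps_mul_eq0.

Definition fps_X : fps F := Fps (fun n => (n == 1%N)%:R).

Lemma fps_coefXn m n : (fps_X ^+ m)`[n] = (n == m)%:R.
Proof.
elim: m n => [|m IHm] n; first by [].
rewrite exprS /=; case: n => [|n]; first by rewrite big_ord1 mul0r.
rewrite big_ord_recl /= mul0r add0r big_ord_recl /= mul1r subSS subn0 IHm.
by rewrite big1 ?addr0 // => i _; rewrite mul0r.
Qed.

Lemma fps_coefXnM m f n :
  (fps_X ^+ m * f)`[n] = if (n < m)%N then 0 else f`[n - m].
Proof.
rewrite /=; under eq_bigr do rewrite fps_coefXn.
case: ltnP => nm.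
  rewrite big1 // => i _; rewrite (_ : _ == _ = false) ?mul0r //.
  by rewrite ltn_eqF // (leq_trans (ltn_ord i)).
have mn : (m < n.+1)%N by [].
rewrite (bigD1 (Ordinal mn)) //= eqxx mul1r big1 ?addr0 // => i ne.
by rewrite -[_ == _]/(i == Ordinal mn) (negPf ne) mul0r.
Qed.

Lemma fps_unit_coef0 f : f`[0] != 0 -> f \is a GRing.unit.
Proof.
move=> f0; pose c : fps F := Fps (fun n => if n is 0 then (f`[0])^-1 else 0).
have [h hE] : exists h, h = 1 - c * f by exists (1 - c * f).
have h0 : h`[0] = 0 by rewrite hE /= big_ord1 /= mulVf // subrr.
have hX p n : (n < p)%N -> (h ^+ p)`[n] = 0.
  elim: p n => // p IHp n np; rewrite exprS /= big1 // => i _.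
  case: (posnP i) => [->|i0]; first by rewrite h0 mul0r.
  rewrite IHp ?mulr0 // ltn_subLR; first by rewrite (leq_trans np) // -add1n leq_add2r.
  by rewrite -ltnS.
pose P n := \sum_(i < n) h ^+ i.
have Pcoef N n : (n < N)%N -> (P N)`[n] = (P n.+1)`[n].
  elim: N => // N IHN; rewrite ltnS leq_eqVlt => /orP[/eqP-> //|nN].
  by rewrite /P big_ord_recr /= -/(P N) hX // addr0 IHN.
pose s : fps F := Fps (fun n => (P n.+1)`[n]).
have sE : s * (c * f) = 1.
  rewrite -[c * f](subKr 1) -hE; apply: fpsP => n.
  transitivity (P n.+1 * (1 - h))`[n].
    apply: eq_bigr => i _; congr (_ * _).
    exact/esym/Pcoef/ltn_ord.
  rewrite mulrC -opprB mulNr -subrX1 opprB.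
  by rewrite -[LHS]/((1 : fps F)`[n] - (h ^+ n.+1)`[n]) hX // subr0.
by apply: (@fps_unitP f (s * c)); rewrite -mulrA.
Qed.

Lemma fps_factor f : f != 0 ->
  exists m, exists2 u, u \is a GRing.unit & f = fps_X ^+ m * u.
Proof.
move=> /fps_ord[m fm fl]; exists m; exists (Fps (fun n => f`[(n + m)%N])).
  by apply: fps_unit_coef0.
apply: fpsP => n; rewrite fps_coefXnM; case: ltnP => [/fl //|mn] /=.
by rewrite subnK.
Qed.

End PowerSeries.

Notation laurent F := {fraction fps F}.

Definition laurent_t (F : fieldType) : laurent F := tofrac (fps_X F).

Lemma laurent_t_neq0 (F : fieldType) : laurent_t F != 0.
Proof.
rewrite tofrac_eq0; apply/eqP => /(congr1 (fun f => f`[1])) /eqP /=.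
by rewrite oner_eq0.
Qed.

Lemma laurentP (F : fieldType) (x : laurent F) :
  exists n (f : fps F), x = laurent_t F ^- n * tofrac f.
Proof.
have [a [b b0 ->]] :
    exists a, exists2 b : fps F, b != 0 & x = tofrac a / tofrac b.
  elim/quotW: x => x; exists x.1, x.2; first exact: denom_ratioP.
  apply: (canRL (mulfK _)); first by rewrite tofrac_eq0 denom_ratioP.
  rewrite /tofrac; unlock tofrac; rewrite -[LHS]FracField.pi_mul.
  apply/eqmodP; rewrite /= FracField.equivfE /FracField.mulf.
  by rewrite !numden_Ratio ?(oner_neq0, mulr1, denom_ratioP) // mulrC.
have [m [u uu ->]] := fps_factor b0; exists m, (u^-1 * a).
rewrite !rmorphM rmorphXn /= rmorphV // invfM mulrC -!mulrA.
by congr (_ * _); rewrite mulrC.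
Qed.

(** * Framed graphs *)

(** Vertices are the thick edges (each regarded as a single vertex) and the
    bivalent vertices. A thin edge with source [None] starts at the bottom
    boundary; one with target [None] ends at the top boundary. *)
Record framed_graph := FramedGraph {
  vertex : finType;
  edge : finType;
  src : edge -> option vertex;
  tgt : edge -> option vertex;
  framing : edge -> int
}.

(** ** Braid graphs

    Positions are indexed from right to left, starting from 0. A braid graph
    on [b] strands is a word, read from bottom to top, whose letters are the
    bivalent vertices and the thick edges (the crossings of the braid diagram).
    [Thick i] joins the strands in positions [i] and [i.+1]. *)
Inductive letter (b : nat) := Bivalent of 'I_b | Thick of 'I_b.-1.

Definition touches (b : nat) (l : letter b) (p : 'I_b) : bool :=
  match l with
  | Bivalent i => p == i
  | Thick i => (p == i :> nat) || (p == i.+1 :> nat)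
  end.

(** A connected component without vertices is a strand that no letter
    touches. *)
Record braid_graph (b : nat) := BraidGraph {
  size_word : nat;
  word : 'I_size_word -> letter b;
  component_has_vertex : forall p : 'I_b, exists v, touches (word v) p
}.

Section BraidGraph.
Variables (b : nat) (G : braid_graph b).

Definition strand (p : 'I_b) : seq 'I_(size_word G) :=
  [seq v <- enum 'I_(size_word G) | touches (word v) p].

(** [Tagged _ j] at position [p] is the [j]-th segment, from the bottom, of the
    strand in position [p] cut at its vertices. *)
Definition thin_edge : finType := {p : 'I_b & 'I_(size (strand p)).+1}.

Definition mk_edge (p : 'I_b) (j : 'I_(size (strand p)).+1) : thin_edge :=
  Tagged (fun p => 'I_(size (strand p)).+1) j.

Definition bottom_edge (p : 'I_b) : thin_edge := @mk_edge p ord0.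
Definition top_edge (p : 'I_b) : thin_edge := @mk_edge p ord_max.

Definition thin_src (e : thin_edge) : option 'I_(size_word G) :=
  if val (tagged e) is j.+1 then onth (strand (tag e)) j else None.
Definition thin_tgt (e : thin_edge) : option 'I_(size_word G) :=
  onth (strand (tag e)) (tagged e).

(** ** Closing strands

    The edge obtained by joining the top and the bottom boundary edges in a
    position is represented by the top one, so that the edges of the closure
    are those of [G] other than the bottom boundary edges in positions
    [< k]. *)
Definition survives (k : nat) : pred thin_edge :=
  fun e => ~~ ((tag e < k)%N && (e == bottom_edge (tag e))).

Definition joined (k : nat) (e : thin_edge) : bool :=
  (tag e < k)%N && (e == top_edge (tag e)).

Definition close_strands (l : thin_edge -> int) (k : nat) : framed_graph :=
  {| vertex := 'I_(size_word G);
     edge := {e : thin_edge | survives k e};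
     src := fun e => thin_src (val e);
     tgt := fun e => if joined k (val e) then thin_tgt (bottom_edge (tag (val e)))
                     else thin_tgt (val e);
     framing := fun e => if joined k (val e)
                         then l (val e) + l (bottom_edge (tag (val e)))
                         else l (val e) |}.

Lemma top_survives (k : nat) (p : 'I_b) : survives k (top_edge p).
Proof.
rewrite /survives negb_and; apply/orP; right; rewrite eq_Tagged /=.
rewrite -val_eqE /= -lt0n; have [v hv] := component_has_vertex G p.
by rewrite size_filter -has_count; apply/hasP; exists v; rewrite ?mem_enum.
Qed.

Definition top_of (l : thin_edge -> int) (k : nat) (p : 'I_b) :
  edge (close_strands l k) := exist _ (top_edge p) (top_survives k p).

End BraidGraph.

(** * Edge rings and ideals *)

(** The polynomial ring on the [x_e]; the variable [y_e] is eliminated by the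
    relation t^(l_e) y_e = x_e. *)
Notation edge_ring F H := {mpoly (laurent F)[#|edge H|]}.

Section EdgeRing.
Variables (F : fieldType) (H : framed_graph).

Definition x_ (e : edge H) : edge_ring F H := 'X_(enum_rank e).
Definition y_ (e : edge H) : edge_ring F H := laurent_t F ^ (- framing e) *: x_ e.

Definition lies_in (S : {set vertex H}) (o : option (vertex H)) : bool :=
  if o is Some v then v \in S else false.

Definition internal_framing (S : {set vertex H}) : int :=
  \sum_(e : edge H | lies_in S (src e) && lies_in S (tgt e)) framing e.

Definition x_out (S : {set vertex H}) : edge_ring F H :=
  \prod_(e : edge H | lies_in S (src e) && ~~ lies_in S (tgt e)) x_ e.

Definition y_in (S : {set vertex H}) : edge_ring F H :=
  \prod_(e : edge H | ~~ lies_in S (src e) && lies_in S (tgt e)) y_ e.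

Definition nonlocal_gen (S : {set vertex H}) : edge_ring F H :=
  laurent_t F ^ internal_framing S *: x_out S - y_in S.

End EdgeRing.

Definition ideal_gen (A : comNzRingType) (I : finType) (g : I -> A) : A -> Prop :=
  fun r => exists c : I -> A, r = \sum_i c i * g i.

Definition ideal_quotient (A : comNzRingType) (I J : A -> Prop) : A -> Prop :=
  fun r => forall s, J s -> I (r * s).

Definition image_of (A B : Type) (f : A -> B) (I : A -> Prop) : B -> Prop :=
  fun s => exists2 r, I r & f r = s.

Definition nonlocal_ideal (F : fieldType) (H : framed_graph) :
  edge_ring F H -> Prop := ideal_gen (@nonlocal_gen F H).

Section CloseMap.
Variables (F : fieldType) (b : nat) (G : braid_graph b).
Variables (l : thin_edge G -> int) (k : 'I_b).

(** The only edge of [close_strands l k] that does not survive in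
    [close_strands l k.+1] is the bottom boundary edge in position [k]. *)
Definition close_var (e : edge (close_strands l k)) :
  edge_ring F (close_strands l k.+1) :=
  if insub (val e) is Some e' then
    x_ F (e' : edge (close_strands l k.+1))
  else laurent_t F ^ (- l (top_edge G k)) *: x_ F (top_of l k.+1 k).

Definition close_map (r : edge_ring F (close_strands l k)) :
  edge_ring F (close_strands l k.+1) :=
  r \mPo [tuple close_var (enum_val i) | i < #|edge (close_strands l k)|].

End CloseMap.

(* Main.v *)
(** Write [lambda S] for the sum of the framings of the edges ending in [S]. Up to
    a power of t, the generator of a set [S] of vertices is the binomial
    t^(lambda S) x_out - x_in, where now [lambda] is additive. The exponent
    vectors out - in are the coboundaries of indicator functions, and a
    coboundary of any integer function decomposes conformally into those of its
    level sets. Hence N(H) is the full twisted lattice ideal of the cut lattice of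
    H, for every framed graph H. Multiplying by a variable only translates
    exponents, so every variable is a nonzerodivisor modulo N(H) (if [lambda] is
    nonzero on some function with zero coboundary, then N(H) contains a nonzero
    constant t^n - 1). Finally, close_map sends the generator of [S] to that of
    [S] in the closure, times a power of t times the variable of the joined edge
    when both ends of that edge lie in [S]. *)

From HB Require Import structures.
Require Import Defs.
From mathcomp Require Import all_boot all_order all_algebra.
From mathcomp Require Import boolp.
From mathcomp Require Import mpoly.
From mathcomp Require Import zify ring.

Set Implicit Arguments.
Unset Strict Implicit.
Unset Printing Implicit Defensive.

Import Order.TTheory GRing.Theory Num.Theory.

(** * Ideals generated by finite families *)

Section GeneratedIdeal.
Local Open Scope ring_scope.
Variables (A : comNzRingType) (I : finType) (g : I -> A).
Implicit Types a b c : A.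

Lemma ideal_gen0 : ideal_gen g 0.
Proof. by exists (fun=> 0); rewrite big1 // => i _; rewrite mul0r. Qed.

Lemma ideal_genD a b : ideal_gen g a -> ideal_gen g b -> ideal_gen g (a + b).
Proof.
move=> [c ->] [d ->]; exists (fun i => c i + d i).
by rewrite -big_split; apply: eq_bigr => i _; rewrite mulrDl.
Qed.

Lemma ideal_genMl a b : ideal_gen g b -> ideal_gen g (a * b).
Proof.
move=> [c ->]; exists (fun i => a * c i).
by rewrite mulr_sumr; apply: eq_bigr => i _; rewrite mulrA.
Qed.

Lemma ideal_genN a : ideal_gen g a -> ideal_gen g (- a).
Proof. by rewrite -mulN1r; apply: ideal_genMl. Qed.

Lemma ideal_genB a b : ideal_gen g a -> ideal_gen g b -> ideal_gen g (a - b).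
Proof. by move=> ga gb; apply/ideal_genD/ideal_genN. Qed.

Lemma ideal_gen_mem i : ideal_gen g (g i).
Proof.
exists (fun j => (j == i)%:R); rewrite (bigD1 i) //= eqxx mul1r big1 ?addr0 //.
by move=> j /negPf ->; rewrite mul0r.
Qed.

(** Taking arbitrary multiples of generators in the last premise means that [P] need not be known to
    be closed under multiplication. *)
Lemma ideal_gen_min (P : A -> Prop) :
  P 0 -> (forall a b, P a -> P b -> P (a + b)) ->
  (forall c i, P (c * g i)) -> forall a, ideal_gen g a -> P a.
Proof. by move=> P0 PD Pg a [c ->]; elim/big_rec: _ => // i b _; apply: PD. Qed.

End GeneratedIdeal.

(** * Integer powers of t *)

Section LaurentT.
Local Open Scope ring_scope.
Variable F : fieldType.
Local Notation t := (laurent_t F).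

Lemma laurent_tD (m n : int) : t ^ (m + n) = t ^ m * t ^ n.
Proof. exact: expfzDr (laurent_t_neq0 F). Qed.

Lemma laurent_tX_neq0 (n : int) : t ^ n != 0.
Proof. exact: expfz_neq0 (laurent_t_neq0 F). Qed.

(** For n a natural number, compare the coefficients of index n as power series; negative exponents
    follow by inversion. *)
Lemma laurent_tX_eq1 (n : int) : t ^ n = 1 -> n = 0.
Proof.
have pos (m : nat) : t ^+ m = 1 -> m = 0%N.
  rewrite /laurent_t -tofracXn -tofrac1 => /eqP.
  rewrite tofrac_eq => /eqP/(congr1 (fun f => fps_coef f m)).
  by rewrite fps_coefXn eqxx /=; case: m => // m /eqP; rewrite oner_eq0.
by case: n => [m /pos -> //|m /(congr1 GRing.inv)]; rewrite invrK invr1 => /pos.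
Qed.

End LaurentT.

(** * The cut lattice and its twisted binomials *)

Section CutLattice.
Local Open Scope ring_scope.
Variables (F : fieldType) (H : framed_graph).
Local Notation t := (laurent_t F).
Local Notation n := #|edge H|.
Local Notation N := (@nonlocal_ideal F H).
Implicit Types (S : {set vertex H}) (f g : vertex H -> int) (m : 'X_{1..n}).

(** Functions on vertices are extended by zero to the boundary, which lies outside every set [S]. *)
Definition at_end f (o : option (vertex H)) : int := oapp f 0 o.

Definition coboundary f (i : 'I_n) : int :=
  at_end f (src (enum_val i)) - at_end f (tgt (enum_val i)).

(** Linear extension of [lambda], which is recovered on indicator functions. *)
Definition weight f : int := \sum_(e : edge H) at_end f (tgt e) * framing e.

Definition indic S (v : vertex H) : int := (v \in S)%:R.

Definition out_mnm S : 'X_{1..n} :=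
  [multinom nat_of_bool (lies_in S (src (enum_val i)) &&
                         ~~ lies_in S (tgt (enum_val i))) | i < n].

Definition in_mnm S : 'X_{1..n} :=
  [multinom nat_of_bool (~~ lies_in S (src (enum_val i)) &&
                         lies_in S (tgt (enum_val i))) | i < n].

Definition cut_binomial S : edge_ring F H :=
  t ^ weight (indic S) *: 'X_[out_mnm S] - 'X_[in_mnm S].

Lemma at_end_indic S o : at_end (indic S) o = (lies_in S o)%:R.
Proof. by case: o. Qed.

Lemma at_endD f g o : at_end (fun v => f v + g v) o = at_end f o + at_end g o.
Proof. by case: o => //=; rewrite addr0. Qed.

Lemma at_endN f o : at_end (fun v => - f v) o = - at_end f o.
Proof. by case: o => //=; rewrite oppr0. Qed.

Lemma coboundaryD f g i :
  coboundary (fun v => f v + g v) i = coboundary f i + coboundary g i.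
Proof. by rewrite /coboundary !at_endD; ring. Qed.

Lemma coboundaryN f i : coboundary (fun v => - f v) i = - coboundary f i.
Proof. by rewrite /coboundary !at_endN; ring. Qed.

Lemma weightD f g : weight (fun v => f v + g v) = weight f + weight g.
Proof.
by rewrite /weight -big_split; apply: eq_bigr => e _; rewrite at_endD mulrDl.
Qed.

Lemma weightN f : weight (fun v => - f v) = - weight f.
Proof.
by rewrite /weight -sumrN; apply: eq_bigr => e _; rewrite at_endN mulNr.
Qed.

Lemma mpolyX_bool (P : pred (edge H)) :
  'X_[[multinom nat_of_bool (P (enum_val i)) | i < n]] =
  \prod_(e | P e) x_ F e.
Proof.
rewrite mpolyXE_id (reindex_onto enum_rank enum_val) => [|i _]; last first.
  exact: enum_valK.
rewrite [RHS]big_mkcond; apply: eq_big => [e|e _]; first by rewrite enum_rankK eqxx.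
by rewrite mnmE enum_rankK /x_; case: (P e); rewrite ?expr1 ?expr0.
Qed.

Lemma x_outE S : x_out F S = 'X_[out_mnm S].
Proof. exact/esym/mpolyX_bool. Qed.

Lemma y_inE S : y_in F S =
  t ^ (- \sum_(e | ~~ lies_in S (src e) && lies_in S (tgt e)) framing e)
    *: 'X_[in_mnm S].
Proof.
rewrite /in_mnm (mpolyX_bool (fun e => ~~ lies_in S (src e) && lies_in S (tgt e))).
rewrite /y_in scaler_prod -sumrN; congr (_ *: _).
by elim/big_rec2: _ => [|e a b _ ->]; rewrite ?laurent_tD.
Qed.

(** The edges ending in [S] are the internal and the incoming ones; the framings of the latter come
    from the variables [y_]. *)
Lemma nonlocal_gen_cut S : nonlocal_gen F S =
  t ^ (- \sum_(e | ~~ lies_in S (src e) && lies_in S (tgt e)) framing e)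
    *: cut_binomial S.
Proof.
rewrite /nonlocal_gen x_outE y_inE /cut_binomial scalerBr scalerA -laurent_tD.
congr (t ^ _ *: _ - _); rewrite /weight /internal_framing.
apply: (canRL (addKr _)); rewrite addrC.
rewrite [LHS]addrC big_mkcond [X in _ + X]big_mkcond -big_split.
apply: eq_bigr => e _; rewrite at_end_indic.
by case: (lies_in S (src e)); case: (lies_in S (tgt e)) => /=;
  rewrite ?mul1r ?mul0r ?addr0 ?add0r.
Qed.

Lemma cut_binomial_mem S : N (cut_binomial S).
Proof.
rewrite -[cut_binomial S](scalerK (laurent_tX_neq0 F
  (- \sum_(e | ~~ lies_in S (src e) && lies_in S (tgt e)) framing e))).
rewrite -nonlocal_gen_cut -mul_mpolyC.
exact/ideal_genMl/ideal_gen_mem.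
Qed.

(* With [S] the set where [f] is positive, moving along the cut [S] keeps every
   exponent between those of [m'] and [m], hence nonnegative. *)
Lemma cut_step m m' f S :
  (forall i, (m i)%:Z - (m' i)%:Z = coboundary f i) ->
  (forall v, (0 < f v) = (v \in S)) ->
  (in_mnm S <= m')%MM.
Proof.
move=> mf fS; apply/mnm_lepP => i; rewrite mnmE.
have {}mf := mf i; rewrite /coboundary in mf.
have pos o : lies_in S o = (0 < at_end f o) by case: o => [v|] //=; rewrite fS.
rewrite !pos; lia.
Qed.

(** Induction on the total absolute value of [f], peeling off the cut along the set where [f] is
    positive. *)
Lemma binomial_mem f m m' :
  (forall i, (m i)%:Z - (m' i)%:Z = coboundary f i) ->
  N (t ^ weight f *: 'X_[m] - 'X_[m']).
Proof.
have [k] := ubnP (\sum_v `|f v|)%N; elim: k => // k IHk in f m m' *.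
wlog [v fv] : f m m' / exists v, 0 < f v => [hw lek mf|].
  have [|f_le0] := pselect (exists v, 0 < f v); first by move=> ?; apply: hw.
  have [|f_ge0] := pselect (exists v, 0 < - f v); last first.
    have f0 v : f v = 0.
      apply/eqP; rewrite eq_le !leNgt; apply/andP; split; apply/negP => fv.
        by apply: f_le0; exists v.
      by apply: f_ge0; exists v; rewrite oppr_gt0.
    have e0 o : at_end f o = 0 by case: o => //= v.
    have -> : m = m'.
      by apply/mnmP => i; have := mf i; rewrite /coboundary !e0; lia.
    rewrite /weight big1 => [|e _]; last by rewrite e0 mul0r.
    by rewrite scale1r subrr; apply: ideal_gen0.
  (* Negating [f] exchanges [m] and [m']; multiplying by [- t ^ weight f] restores the required
     binomial. *)
  move=> ex; have := hw (fun v => - f v) m' m ex.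
  rewrite (eq_bigr (fun v => `|f v|)%N) => [|v _]; last exact: abszN.
  move=> /(_ lek) memN.
  have {}memN : N (t ^ weight (fun v => - f v) *: 'X_[m'] - 'X_[m]).
    by apply: memN => i; rewrite coboundaryN -mf opprB.
  have := ideal_genMl (- (t ^ weight f)%:MP) memN.
  rewrite mulNr mul_mpolyC scalerBr scalerA -laurent_tD weightN subrr scale1r.
  by rewrite opprB.
move=> lek mf; pose S := [set v | 0 < f v].
have fS v' : (0 < f v') = (v' \in S) by rewrite inE.
have le_in := cut_step mf fS.
(* [m2] is [m'] moved once along the cut [S]; by [le_in] the truncated subtraction is exact. *)
pose m2 := (m' - in_mnm S + out_mnm S)%MM.
pose g v := f v + - indic S v.
have mg i : (m i)%:Z - (m2 i)%:Z = coboundary g i.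
  rewrite coboundaryD coboundaryN -mf /coboundary !at_end_indic.
  have /mnm_lepP/(_ i) := le_in.
  rewrite mnmDE mnmBE !mnmE.
  by case: (lies_in S _); case: (lies_in S _) => /=; lia.
(* Passing to [g] lowers the absolute value by one on [S] and keeps it elsewhere; [v] makes the
   decrease strict. *)
have /IHk/(_ mg) memg : (\sum_v `|g v| < k)%N.
  apply: (@leq_trans (\sum_v `|f v|)%N); last by rewrite -ltnS.
  rewrite (bigD1 v) //= [X in (_ < X)%N](bigD1 v) //= -addSn.
  apply: leq_add; first by rewrite /g /indic -fS fv; lia.
  by apply: leq_sum => w _; rewrite /g /indic -fS; case: ltP; lia.
(* The two binomials telescope: the monomial of exponent [m2] cancels. *)
have := ideal_genD (ideal_genMl (t ^ weight (indic S))%:MP memg)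
  (ideal_genMl 'X_[m' - in_mnm S] (cut_binomial_mem S)).
rewrite mul_mpolyC scalerBr scalerA -laurent_tD weightD weightN addrC.
rewrite /cut_binomial mulrBr -scalerAr -!mpolyXD submK // -/m2.
by rewrite [weight _ + _]addrC subrK addrC addrA subrK.
Qed.

(* The value at [w] of the twisted indicator function of the cut lattice; it is
   well defined only when [weight] vanishes on the kernel of [coboundary]. *)
Definition cut_char (w : 'I_n -> int) : laurent F :=
  if pselect (exists f, coboundary f =1 w) is left ex
  then t ^ (- weight (projT1 (cid ex))) else 0.

(** Twisted sum of the coefficients over the coset of [u] modulo the cut lattice: [cut_char] is 0
    off the lattice. *)
Definition class_sum (u : 'I_n -> int) (r : edge_ring F H) : laurent F :=
  \sum_(m <- msupp r) r@_m * cut_char (fun i => (m i)%:Z - u i).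

(** A larger list of exponents gives the same sum, so polynomials with different supports can be
    added. *)
Lemma class_sumE u r (s : seq 'X_{1..n}) :
  uniq s -> {subset msupp r <= s} ->
  class_sum u r = \sum_(m <- s) r@_m * cut_char (fun i => (m i)%:Z - u i).
Proof.
move=> us sub; rewrite [RHS](bigID (mem (msupp r))) /=.
rewrite [X in _ + X]big1 ?addr0 => [|m /memN_msupp_eq0 ->]; last exact: mul0r.
rewrite -big_filter; apply: perm_big; apply: uniq_perm => [||m].
- exact: msupp_uniq.
- exact: filter_uniq.
by rewrite mem_filter; case: (boolP (m \in msupp r)) => //= /sub.
Qed.

Lemma class_sumD u p q : class_sum u (p + q) = class_sum u p + class_sum u q.
Proof.
pose s := undup (msupp p ++ msupp q).
rewrite !(@class_sumE u _ s) ?undup_uniq //.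
- by rewrite -big_split; apply: eq_bigr => m _; rewrite mcoeffD mulrDl.
- by move=> m; rewrite mem_undup mem_cat orbC => ->.
- by move=> m; rewrite mem_undup mem_cat => ->.
- by move=> m /msuppD_le; rewrite mem_undup.
Qed.

Lemma class_sum0 u : class_sum u 0 = 0.
Proof. by rewrite /class_sum msupp0 big_nil. Qed.

Lemma class_sumZX u c m :
  class_sum u (c *: 'X_[m]) = c * cut_char (fun i => (m i)%:Z - u i).
Proof.
rewrite (@class_sumE u _ [:: m]) // => [|m']; last first.
  by move/msuppZ_le; rewrite msuppX.
by rewrite big_seq1 mcoeffZ mcoeffX eqxx mulr1.
Qed.

(** A monomial factor translates all exponents, which amounts to moving the base point the other
    way. [u] is integer-valued so that this is always possible. *)
Lemma class_sumXM u a r :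
  class_sum u ('X_[a] * r) = class_sum (fun i => u i - (a i)%:Z) r.
Proof.
rewrite [r in LHS]mpolyE mulr_sumr.
rewrite (big_morph _ (class_sumD u) (class_sum0 u)).
apply: eq_bigr => m _; rewrite -scalerAr -mpolyXD class_sumZX.
by congr (_ * cut_char _); apply: funext => i; rewrite mnmDE; lia.
Qed.

(** * Class sums detect the ideal when the weight depends only on the coboundary *)

Section NoHolonomy.
Hypothesis noholonomy : forall f, coboundary f =1 (fun=> 0) -> weight f = 0.

Lemma cut_charE f w : coboundary f =1 w -> cut_char w = t ^ (- weight f).
Proof.
move=> fw; rewrite /cut_char; case: pselect => [ex|[]]; last by exists f.
case: cid => g /= gw; congr (t ^ - _); apply/eqP; rewrite -subr_eq0 -weightN.
rewrite -weightD; apply/eqP/noholonomy => i.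
by rewrite coboundaryD coboundaryN gw fw subrr.
Qed.

(** Multiplicativity of the character on the lattice; off the lattice neither [w] nor [w'] is a
    coboundary and both sides vanish. *)
Lemma cut_char_shift f w w' : (forall i, w' i - w i = coboundary f i) ->
  t ^ weight f * cut_char w' = cut_char w.
Proof.
move=> ww'; have [[g gw]|nex] := pselect (exists g, coboundary g =1 w).
  rewrite (cut_charE gw) (@cut_charE (fun v => f v + g v)) => [|i].
    by rewrite -laurent_tD weightD opprD addrA subrr add0r.
  by rewrite coboundaryD gw -ww' subrK.
rewrite {2}/cut_char; case: pselect => // _.
rewrite /cut_char; case: pselect => [[g gw]|_]; last exact: mulr0.
case: nex; exists (fun v => g v + - f v) => i.
by rewrite coboundaryD coboundaryN gw -ww' opprB addrC subrK.
Qed.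

Lemma class_sum_binomial u c f m m' :
  (forall i, (m i)%:Z - (m' i)%:Z = coboundary f i) ->
  class_sum u (c *: (t ^ weight f *: 'X_[m] - 'X_[m'])) = 0.
Proof.
move=> mf; rewrite scalerBr scalerA -scaleNr class_sumD !class_sumZX.
rewrite -mulrA (@cut_char_shift f (fun i => (m' i)%:Z - u i)) => [|i].
  by rewrite mulNr subrr.
by rewrite -mf; lia.
Qed.

(** A monomial multiple of a cut binomial is again a twisted binomial with congruent exponents, and
    its two terms cancel. *)
Lemma class_sum_nonlocal u r : N r -> class_sum u r = 0.
Proof.
move: r; apply: ideal_gen_min => [|p q p0 q0|c S]; first exact: class_sum0.
  by rewrite class_sumD p0 q0 addr0.
rewrite nonlocal_gen_cut -scalerAr scalerAl; set d := _ *: c.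
rewrite [d]mpolyE mulr_suml (big_morph _ (class_sumD u) (class_sum0 u)).
apply: big1 => m _; rewrite -scalerAl mulrBr -scalerAr -!mpolyXD.
apply: class_sum_binomial => i.
rewrite /coboundary !mnmDE !mnmE !at_end_indic.
by case: (lies_in S _); case: (lies_in S _) => /=; lia.
Qed.

(** Induction on the number of monomials: two congruent exponents are merged by a binomial of the
    ideal, while an exponent alone in its class would give a nonzero class sum. *)
Lemma class_sum_eq0_nonlocal r : (forall u, class_sum u r = 0) -> N r.
Proof.
have [k] := ubnP (size (msupp r)); elim: k => // k IHk in r * => lek r0.
case: (boolP (r == 0)) => [/eqP->|rn0]; first exact: ideal_gen0.
have /hasP[m mr _] : has predT (msupp r).
  by rewrite has_predT lt0n size_eq0 msupp_eq0.
have [[m' [m'r ne [f mf]]]|nex] := pselect (exists m', [/\ m' \in msupp r, m' != m &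
    exists f, forall i, (m i)%:Z - (m' i)%:Z = coboundary f i]).
  pose q := r@_m' *: (t ^ weight f *: 'X_[m] - 'X_[m']).
  have qN : N q by rewrite /q -mul_mpolyC; apply/ideal_genMl/binomial_mem.
  rewrite -[r](addrK q); apply: ideal_genB => //; apply: IHk => [|u]; last first.
    by rewrite class_sumD r0 class_sum_binomial // addr0.
  (* Adding [q] kills the term at [m'] and otherwise touches only [m], already in the support. *)
  rewrite -ltnS (leq_trans _ lek) // ltnS (perm_size (perm_to_rem m'r)) /= ltnS.
  apply: uniq_leq_size => [|a]; first exact: msupp_uniq.
  rewrite (mem_rem_uniq _ (msupp_uniq r)) inE !mcoeff_msupp.
  rewrite mcoeffD mcoeffZ mcoeffB mcoeffZ !mcoeffX.
  have [<-|ma] := eqVneq m' a.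
    by rewrite [m == m']eq_sym (negPf ne) mulr0 sub0r mulrN mulr1 subrr eqxx.
  have [<- _|_] := eqVneq m a; first by rewrite -mcoeff_msupp mr.
  by rewrite mulr0 subrr mulr0 addr0.
(* Based at [m], the class sum reduces to [r@_m] times a power of t. *)
have := r0 (fun i => (m i)%:Z); rewrite /class_sum (bigD1_seq m) ?msupp_uniq //=.
rewrite (@cut_charE (fun=> 0)) => [|i]; last first.
  by rewrite subrr /coboundary; case: (src _); case: (tgt _).
rewrite big_seq_cond big1 => [|a /andP[ar ne]].
  move/eqP; rewrite addr0 mulf_eq0 (negPf (laurent_tX_neq0 _ _)) orbF.
  by rewrite (negPf (_ : r@_m != 0)) // -mcoeff_msupp.
rewrite /cut_char; case: pselect => [[f fa]|_]; last exact: mulr0.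
case: nex; exists a; split=> //; exists (fun v => - f v) => i.
by rewrite coboundaryN fa opprB.
Qed.

End NoHolonomy.

Lemma nonlocal_regular (e : edge H) r : N (x_ F e * r) -> N r.
Proof.
move=> er.
have [[f [f0 wf]]|nex] := pselect (exists f,
    coboundary f =1 (fun=> 0) /\ weight f <> 0).
  have tf : t ^ weight f - 1 != 0.
    by rewrite subr_eq0; apply/eqP => /laurent_tX_eq1.
  (* With both exponents zero, the binomial is an invertible constant, so the ideal is the whole
     ring. *)
  have := @binomial_mem f 0%MM 0%MM (fun i => etrans (subrr _) (esym (f0 i))).
  rewrite mpolyX0 -mul_mpolyC -[X in _ - X]mpolyC1 mulr1 -mpolyCB.
  move/(ideal_genMl (r * (t ^ weight f - 1)^-1%:MP)).
  by rewrite -mulrA -mpolyCM mulVf // mpolyC1 mulr1.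
have noholonomy f : coboundary f =1 (fun=> 0) -> weight f = 0.
  by move=> f0; apply: contrapT => wf; apply: nex; exists f.
apply: class_sum_eq0_nonlocal => // u.
(* The base point is shifted in advance so that removing the variable brings it back to [u]. *)
have := class_sum_nonlocal noholonomy (fun i => u i + U_(enum_rank e)%MM i) er.
by rewrite class_sumXM; under [X in class_sum X]funext do rewrite addrK.
Qed.

End CutLattice.

(** * Effect of closing one strand on the generators *)

Section Closing.
Local Open Scope ring_scope.
Variables (F : fieldType) (b : nat) (G : braid_graph b).
Variables (l : thin_edge G -> int) (k : 'I_b).
Local Notation t := (laurent_t F).
Local Notation H := (close_strands l k).
Local Notation H' := (close_strands l k.+1).
Local Notation T := (top_edge G k).
Local Notation B := (bottom_edge G k).
Local Notation z := (x_ F (top_of l k.+1 k)).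
Implicit Types (S : {set 'I_(size_word G)}) (e : thin_edge G).

Lemma strand_size_gt0 (p : 'I_b) : (0 < size (strand G p))%N.
Proof.
rewrite size_filter -has_count; have [v hv] := component_has_vertex G p.
by apply/hasP; exists v; rewrite ?mem_enum.
Qed.

Lemma top_neq_bottom : T != B.
Proof.
by rewrite eq_Tagged /= -val_eqE /= -lt0n strand_size_gt0.
Qed.

Lemma bottom_survives : survives k B.
Proof. by rewrite /survives /= ltnn. Qed.

Lemma survivesS e : survives k.+1 e = survives k e && (e != B).
Proof.
rewrite /survives ltnS leq_eqVlt andb_orl negb_or andbC; congr (_ && ~~ _).
apply/andP/eqP => [[/eqP/val_inj <- /eqP //]|->].
by split.
Qed.

Lemma joinedS e : joined k.+1 e = joined k e || (e == T).
Proof.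
rewrite /joined ltnS leq_eqVlt andb_orl orbC; congr (_ || _).
apply/andP/eqP => [[/eqP/val_inj <- /eqP //]|->].
by split.
Qed.

Lemma joined_top : joined k T = false.
Proof. by rewrite /joined /= ltnn. Qed.

Lemma joined_bottom : joined k B = false.
Proof. by rewrite /joined /= ltnn. Qed.

Lemma thin_tgt_top : thin_tgt T = None.
Proof. by rewrite /thin_tgt /= onth_default. Qed.

(** Target and framing are expressed on the edges of [G], a common index type for both closures. *)
Definition tgt_after (j : nat) e :=
  if joined j e then thin_tgt (bottom_edge G (tag e)) else thin_tgt e.

Definition framing_after (j : nat) e :=
  if joined j e then l e + l (bottom_edge G (tag e)) else l e.

(** Among the edges of [H], only [B] takes the default value. *)
Definition closed_var e : edge_ring F H' :=
  if insub e is Some e' then x_ F (e' : edge H') else t ^ (- l T) *: z.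

Lemma closed_var_val (e : edge H') : closed_var (val e) = x_ F e.
Proof. by rewrite /closed_var valK. Qed.

Lemma closed_var_bottom : closed_var B = t ^ (- l T) *: z.
Proof.
by rewrite /closed_var insubF // survivesS eqxx andbF.
Qed.

Lemma closed_var_top : closed_var T = z.
Proof. exact: (closed_var_val (top_of l k.+1 k)). Qed.

HB.instance Definition _ := GRing.RMorphism.copy (@close_map F b G l k)
  (comp_mpoly [tuple close_var F (enum_val i) | i < #|edge H|]).

Lemma close_map_x (e : edge H) : close_map (x_ F e) = closed_var (val e).
Proof.
by rewrite /close_map /x_ comp_mpolyXU -tnth_nth tnth_mktuple enum_rankK.
Qed.

Lemma close_mapZ c (p : edge_ring F H) : close_map (c *: p) = c *: close_map p.
Proof. exact: comp_mpolyZ. Qed.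

(** Lifting coefficients is what makes the image of an ideal an ideal. *)
Lemma close_map_surj (q : edge_ring F H') : exists p, close_map p = q.
Proof.
elim/mpolyind: q => [|c m q _ _ [p <-]].
  by exists 0; rewrite rmorph0.
suff [p' p'm] : exists p', close_map p' = 'X_[m] :> edge_ring F H'.
  by exists (c *: p' + p); rewrite rmorphD /= close_mapZ p'm.
rewrite mpolyXE_id; elim/big_rec: _ => [|i q' _ [p' <-]].
  by exists 1; rewrite rmorph1.
have sv : survives k (val (enum_val i)).
  by have := valP (enum_val i); rewrite survivesS => /andP[].
exists (x_ F (exist (fun e => survives k e) _ sv : edge H) ^+ m i * p').
by rewrite rmorphM rmorphXn /= close_map_x closed_var_val /x_ enum_valK.
Qed.

Definition unaffected e := [&& survives k e, e != B & e != T].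

(** Isolates the two edges to be joined; a general commutative law covers both products of variables
    and sums of framings. *)
Lemma big_edges (R : Type) (idx : R) (op : Monoid.com_law idx)
    (P : pred (thin_edge G)) (f : thin_edge G -> R) :
  \big[op/idx]_(e : edge H | P (val e)) f (val e) =
  op (if P B then f B else idx) (op (if P T then f T else idx)
     (\big[op/idx]_(e | unaffected e && P e) f e)).
Proof.
transitivity (\big[op/idx]_(e | survives k e && P e) f e).
  exact/esym/(big_sub_cond (survives k) P f).
rewrite big_mkcondr (bigD1 B bottom_survives) /= (bigD1 T) /=; last first.
  by rewrite top_survives top_neq_bottom.
congr (op _ (op _ _)); rewrite [RHS]big_mkcondr.
by apply: eq_bigl => e; rewrite /unaffected andbA.
Qed.

Lemma big_edgesS (R : Type) (idx : R) (op : Monoid.com_law idx)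
    (P : pred (thin_edge G)) (f : thin_edge G -> R) :
  \big[op/idx]_(e : edge H' | P (val e)) f (val e) =
  op (if P T then f T else idx)
     (\big[op/idx]_(e | unaffected e && P e) f e).
Proof.
transitivity (\big[op/idx]_(e | survives k.+1 e && P e) f e).
  exact/esym/(big_sub_cond (survives k.+1) P f).
rewrite big_mkcondr (bigD1 T (top_survives G k.+1 k)) /=.
congr (op _ _); rewrite [RHS]big_mkcondr.
by apply: eq_bigl => e; rewrite /unaffected survivesS andbA.
Qed.

Lemma tgt_after_unaffected e : unaffected e -> tgt_after k.+1 e = tgt_after k e.
Proof. by case/and3P=> _ _ /negPf eT; rewrite /tgt_after joinedS eT orbF. Qed.

Lemma framing_after_unaffected e :
  unaffected e -> framing_after k.+1 e = framing_after k e.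
Proof. by case/and3P=> _ _ /negPf eT; rewrite /framing_after joinedS eT orbF. Qed.

(** If the joined edge has both ends in [S], then before closing [T] leaves [S] and [B] enters it,
    so both terms carry [z]; afterwards the edge is internal and only its framing remains. In the
    other cases the contributions agree. *)
Lemma close_map_nonlocal_gen S :
  close_map (nonlocal_gen F (S : {set vertex H})) =
  (if lies_in (S : {set vertex H}) (thin_src T) &&
      lies_in (S : {set vertex H}) (thin_tgt B)
   then t ^ (- (l T + l B)) *: z else 1) *
  nonlocal_gen F (S : {set vertex H'}).
Proof.
pose inS := lies_in (S : {set vertex H}).
rewrite -/inS; set p := inS (thin_src T); set q := inS (thin_tgt B).
pose Co := \prod_(e | unaffected e &&
  (inS (thin_src e) && ~~ inS (tgt_after k e))) closed_var e.
pose Ci := \prod_(e | unaffected e &&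
  (~~ inS (thin_src e) && inS (tgt_after k e)))
  (t ^ (- framing_after k e) *: closed_var e).
pose W := \sum_(e | unaffected e &&
  (inS (thin_src e) && inS (tgt_after k e))) framing_after k e.
have tB : tgt_after k B = thin_tgt B by rewrite /tgt_after joined_bottom.
have tT : tgt_after k T = None.
  by rewrite /tgt_after joined_top thin_tgt_top.
have tT' : tgt_after k.+1 T = thin_tgt B.
  by rewrite /tgt_after joinedS eqxx orbT.
have fB : framing_after k B = l B by rewrite /framing_after joined_bottom.
have fT' : framing_after k.+1 T = l T + l B.
  by rewrite /framing_after joinedS eqxx orbT.
have xo : close_map (x_out F (S : {set vertex H})) = (if p then z else 1) * Co.
  rewrite /x_out rmorph_prod /=; under eq_bigr do rewrite close_map_x.
  rewrite (big_edges _ (fun e => inS (thin_src e) && ~~ inS (tgt_after k e))).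
  by rewrite /= tT andbT mul1r closed_var_top.
have yi : close_map (y_in F (S : {set vertex H})) =
    (if q then t ^ (- (l T + l B)) *: z else 1) * Ci.
  rewrite /y_in rmorph_prod /=.
  under eq_bigr do rewrite /y_ close_mapZ close_map_x.
  rewrite (big_edges _ (fun e => ~~ inS (thin_src e) && inS (tgt_after k e))
    (fun e => t ^ (- framing_after k e) *: closed_var e)).
  rewrite /= tT andbF mul1r tB fB closed_var_bottom.
  (* One power of t comes from [y_] at [B], the other from the image of its variable. *)
  by rewrite scalerA -laurent_tD opprD [- l B + _]addrC.
have w : internal_framing (S : {set vertex H}) = W.
  rewrite /internal_framing.
  rewrite (big_edges _ (fun e => inS (thin_src e) && inS (tgt_after k e))
    (framing_after k)).
  by rewrite /= tT andbF !add0r.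
have xo' : x_out F (S : {set vertex H'}) = (if p && ~~ q then z else 1) * Co.
  rewrite /x_out; under eq_bigr do rewrite -closed_var_val.
  rewrite (big_edgesS _ (fun e => inS (thin_src e) && ~~ inS (tgt_after k.+1 e))).
  rewrite /= tT' closed_var_top; congr (_ * _); apply: eq_bigl => e.
  by apply: andb_id2l => /tgt_after_unaffected ->.
have yi' : y_in F (S : {set vertex H'}) =
    (if ~~ p && q then t ^ (- (l T + l B)) *: z else 1) * Ci.
  rewrite /y_in; under eq_bigr do rewrite /y_ -closed_var_val.
  rewrite (big_edgesS _ (fun e => ~~ inS (thin_src e) && inS (tgt_after k.+1 e))
    (fun e => t ^ (- framing_after k.+1 e) *: closed_var e)).
  rewrite /= tT' fT' closed_var_top; congr (_ * _).
  apply: eq_big => [e|e /andP[/framing_after_unaffected -> //]].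
  by apply: andb_id2l => /tgt_after_unaffected ->.
have w' : internal_framing (S : {set vertex H'}) =
    (if p && q then l T + l B else 0) + W.
  rewrite /internal_framing.
  rewrite (big_edgesS _ (fun e => inS (thin_src e) && inS (tgt_after k.+1 e))
    (framing_after k.+1)).
  rewrite /= tT' fT'; congr (_ + _).
  apply: eq_big => [e|e /andP[/framing_after_unaffected -> //]].
  by apply: andb_id2l => /tgt_after_unaffected ->.
rewrite /nonlocal_gen rmorphB /= close_mapZ {}xo {}yi {}w {}xo' {}yi' {}w'.
case: p; case: q; rewrite /= ?mul1r ?add0r // mulrBr -!scalerAl.
by rewrite -scalerAr scalerA -laurent_tD addKr.
Qed.

(** Either the image of the generator already contains [z], up to an invertible power of t, or [z]
    is supplied by the top variable of [H]. *)
Lemma nonlocal_gen_mul_z S :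
  image_of (@close_map F b G l k) (@nonlocal_ideal F H)
    (nonlocal_gen F (S : {set vertex H'}) * z).
Proof.
have := close_map_nonlocal_gen S; case: ifP => _ gS.
  exists ((t ^ (l T + l B))%:MP * nonlocal_gen F (S : {set vertex H})).
    exact/ideal_genMl/ideal_gen_mem.
  rewrite mul_mpolyC close_mapZ gS -scalerAl scalerA -laurent_tD subrr scale1r.
  exact: mulrC.
exists (x_ F (top_of l k k) * nonlocal_gen F (S : {set vertex H})).
  exact/ideal_genMl/ideal_gen_mem.
by rewrite rmorphM /= gS mul1r close_map_x closed_var_top mulrC.
Qed.

End Closing.

(** * The ideal quotient *)

Theorem theorem1p1 (F : fieldType) (b : nat) (G : braid_graph b)
    (l : thin_edge G -> int) (k : 'I_b) (hk : (k.+1 < b)%N)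
    (r : edge_ring F (close_strands l k.+1)) :
  ideal_quotient
    (image_of (@close_map F b G l k) (@nonlocal_ideal F (close_strands l k)))
    (ideal_gen (fun _ : 'I_1 => x_ F (top_of l k.+1 k))) r
  <-> nonlocal_ideal r.
Proof.
split=> [|rN s [c ->]].
  move=> /(_ _ (ideal_gen_mem _ ord0))[p pN pE].
  (* By regularity of the joined variable, it remains to see that the image of the ideal lies in the
     ideal of the closure. *)
  apply: (@nonlocal_regular _ _ (top_of l k.+1 k)); rewrite mulrC -pE.
  move: p pN {pE}; apply: ideal_gen_min => [|p q pN qN|c S].
  - by rewrite rmorph0; apply: ideal_gen0.
  - by rewrite rmorphD; apply: ideal_genD.
  rewrite rmorphM /= close_map_nonlocal_gen mulrA.
  exact/ideal_genMl/ideal_gen_mem.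
(* Conversely, lifting the coefficient reduces the claim to the product of [r] with the variable
   itself. *)
rewrite big_ord1 mulrCA; have [c' <-] := close_map_surj (c ord0).
suff [p pN pE] : image_of (@close_map F b G l k)
    (@nonlocal_ideal F (close_strands l k)) (r * x_ F (top_of l k.+1 k))%R.
  by exists (c' * p)%R; [apply: ideal_genMl | rewrite rmorphM /= pE].
move: r rN; apply: ideal_gen_min => [|p q [p' p'N p'E] [q' q'N q'E]|{c'}d S].
- by exists 0%R; [apply: ideal_gen0 | rewrite rmorph0 mul0r].
- by exists (p' + q')%R; [apply: ideal_genD | rewrite rmorphD /= p'E q'E mulrDl].
have [c' <-] := close_map_surj d; have [p pN pE] := nonlocal_gen_mul_z F l k S.
by exists (c' * p)%R; [apply: ideal_genMl | rewrite rmorphM /= pE mulrA].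
Qed.
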